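(* Let $m,n$ be positive integers and let $\mathcal{A}$ be a real $m$-th order $n$-dimensional tensor satisfying any of the following conditions: (i) $-\mathcal{A}$ is a $Z$-tensor; (ii) $\mathcal{A}$ is a $Z$-tensor. Then $\mathcal{A}$ can have at most $\rho_n:=2^n-1$ Pareto-eigenvalues.
   Context: A real $m$-th order $n$-dimensional tensor is an array $\mathcal{A}=(a_{i_1\cdots i_m})$ with $a_{i_1\cdots i_m}\in\mathbb{R}$ for $1\le i_1,\ldots,i_m\le n$. For $x\in\mathbb{R}^n$, $\mathcal{A}x^{m-1}\in\mathbb{R}^n$ is the vector with $(\mathcal{A}x^{m-1})_i=\sum_{i_2,\ldots,i_m=1}^n a_{ii_2\cdots i_m}x_{i_2}\cdots x_{i_m}$, and $x^{[m-1]}=(x_1^{m-1},\ldots,x_n^{m-1})^\top$. Vector inequalities are componentwise. $\mathcal{A}$ is a $Z$-tensor if all its off-diagonal entries (the $a_{i_1\cdots i_m}$ whose indices $i_1,\ldots,i_m$ are not all equal) are nonpositive. A Pareto-eigenvalue of $\mathcal{A}$ is a real number $\lambda$ for which there exists $x\in\mathbb{R}^n\setminus\{0\}$ with $x\ge 0$, $\lambda x^{[m-1]}-\mathcal{A}x^{m-1}\ge 0$ and $\langle x,\lambda x^{[m-1]}-\mathcal{A}x^{m-1}\rangle=0$. *)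

(* Defs.v *)
From HB Require Import structures.
From mathcomp Require Import all_boot all_order all_algebra.
From mathcomp Require Import boolp classical_sets functions cardinality reals.

Set Implicit Arguments.
Unset Strict Implicit.
Unset Printing Implicit Defensive.

Import Order.TTheory GRing.Theory Num.Theory.
Local Open Scope ring_scope.

Definition tensor (R : realType) (m n : nat) := {ffun m.-tuple 'I_n -> R}.

Definition nonneg_vec (R : realType) (n : nat) (x : 'cV[R]_n) : Prop :=
  forall i, 0 <= x i 0.

Definition inner (R : realType) (n : nat) (x y : 'cV[R]_n) : R :=
  \sum_(i < n) x i 0 * y i 0.

Definition hpow (R : realType) (n : nat) (x : 'cV[R]_n) (k : nat) : 'cV[R]_n :=
  \col_i x i 0 ^+ k.

(* A positive order is written m.+1, so that the power x^{order - 1} has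
   exponent m; the tuple t stands for the indices (i_2, ..., i_order). *)
Definition tensor_apply (R : realType) (m n : nat)
    (A : tensor R m.+1 n) (x : 'cV[R]_n) : 'cV[R]_n :=
  \col_i \sum_(t : m.-tuple 'I_n) A [tuple of i :: t] * \prod_(j <- t) x j 0.

Definition Z_tensor (R : realType) (m n : nat) (A : tensor R m n) : Prop :=
  forall t : m.-tuple 'I_n, ~~ constant t -> A t <= 0.

Definition pareto_eigenvalue (R : realType) (m n : nat)
    (A : tensor R m.+1 n) (lambda : R) : Prop :=
  exists x : 'cV[R]_n,
    let w := lambda *: hpow x m - tensor_apply A x in
    [/\ x <> 0, nonneg_vec x, nonneg_vec w & inner x w = 0].

(* Main.v *)
(* The support of a Pareto-eigenvector determines its eigenvalue, and there are
   2^n - 1 nonempty supports.  For uniqueness, negate A if needed so that its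
   off-diagonal entries are nonnegative.  If x and y have the same support and
   eigenvalues l and k, take the least c with y <= c x and an index i of the
   support where y_i = c x_i.  Comparing term by term,
   k y_i^(m-1) = (A y^(m-1))_i <= c^(m-1) (A x^(m-1))_i = l y_i^(m-1),
   because the diagonal terms agree and the others are monotone in the vector.
   So k <= l, and equality follows by symmetry. *)
Require Import Defs.
From HB Require Import structures.
From mathcomp Require Import all_boot all_order all_algebra.
From mathcomp Require Import boolp classical_sets functions cardinality reals.

Set Implicit Arguments.
Unset Strict Implicit.
Unset Printing Implicit Defensive.

Import Order.TTheory GRing.Theory Num.Theory.
Local Open Scope classical_set_scope.
Local Open Scope card_scope.
Local Open Scope ring_scope.

Definition vec_support (R : realType) (n : nat) (x : 'cV[R]_n) : {set 'I_n} :=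
  finset (fun i => 0 < x i 0).

(** What complementarity yields at the positive coordinates. Being an equation, it survives negating
    [A] and [l], which would reverse the sign condition in [pareto_eigenvalue]. *)
Definition eigen_on_support (R : realType) (m n : nat)
    (A : tensor R m.+1 n) (l : R) (x : 'cV[R]_n) : Prop :=
  forall i, 0 < x i 0 -> tensor_apply A x i 0 = l * x i 0 ^+ m.

Lemma vec_support_neq0 (R : realType) (n : nat) (x : 'cV[R]_n) :
  x <> 0 -> nonneg_vec x -> vec_support x != finset.set0.
Proof.
move=> xn0 x0; apply: contra_not_neq xn0 => sx0.
apply/colP => i; rewrite mxE; apply/eqP; rewrite eq_le x0 andbT leNgt.
by move/setP/(_ i): sx0; rewrite !inE => ->.
Qed.

Lemma pareto_eigenvalue_support (R : realType) (m n : nat)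
    (A : tensor R m.+1 n) (l : R) :
  pareto_eigenvalue A l -> exists x : 'cV[R]_n,
    [/\ vec_support x != finset.set0, nonneg_vec x & eigen_on_support A l x].
Proof.
move=> [x [xn0 x0 w0 xw]]; exists x; split=> //; first exact: vec_support_neq0.
move=> i xi; have := psumr_eq0P (fun j _ => mulr_ge0 (x0 j) (w0 j)) xw (i := i) isT.
move/eqP; rewrite mulf_eq0 gt_eqF //= !mxE subr_eq0 => /eqP e.
by rewrite e.
Qed.

Lemma eigen_on_supportN (R : realType) (m n : nat)
    (A : tensor R m.+1 n) (l : R) (x : 'cV[R]_n) :
  eigen_on_support A l x -> eigen_on_support (- A) (- l) x.
Proof.
move=> Al i xi; rewrite mulNr -Al // !mxE -sumrN.
by apply: eq_bigr => t _; rewrite ffunE mulNr.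
Qed.

Lemma tensor_apply_le_scale (R : realType) (m n : nat) (A : tensor R m.+1 n)
    (x y : 'cV[R]_n) (c : R) (i : 'I_n) :
  Z_tensor (- A) -> nonneg_vec y ->
  (forall j, y j 0 <= c * x j 0) -> y i 0 = c * x i 0 ->
  tensor_apply A y i 0 <= c ^+ m * tensor_apply A x i 0.
Proof.
move=> ZA y0 yx yi; rewrite !mxE mulr_sumr; apply: ler_sum => t _.
have -> : c ^+ m * (A [tuple of i :: t] * \prod_(j <- t) x j 0) =
    A [tuple of i :: t] * \prod_(j <- t) (c * x j 0).
  rewrite mulrCA big_split /= big_const_seq count_predT iter_mulr_1.
  by congr (_ * (_ * _)); rewrite size_tuple.
(* The diagonal entry may have either sign, so its two products must be equal: all indices in [t]
   are [i], where [yi] applies. *)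
have [ct|ct] := boolP (constant (i :: t)).
  have {}ct : all (pred1 i) t := ct.
  rewrite le_eqVlt; apply/orP; left; apply/eqP; congr (_ * _).
  by apply: eq_big_seq => j /(allP ct) /eqP ->.
apply: ler_wpM2l; first by have := ZA _ ct; rewrite ffunE oppr_le0.
by apply: ler_prod => j _; rewrite y0 yx.
Qed.

Lemma eigen_on_support_le (R : realType) (m n : nat) (A : tensor R m.+1 n)
    (x y : 'cV[R]_n) (l k : R) :
  Z_tensor (- A) -> nonneg_vec x -> nonneg_vec y ->
  vec_support x = vec_support y -> vec_support x != finset.set0 ->
  eigen_on_support A l x -> eigen_on_support A k y -> k <= l.
Proof.
move=> ZA x0 y0 sxy /set0Pn[i0]; rewrite inE => xi0 Ax Ay.
have sE j : (0 < x j 0) = (0 < y j 0) by move/setP/(_ j): sxy; rewrite !inE.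
(* The least c with y <= c x is the largest ratio y_j / x_j over the support, attained at [i]. *)
case: (@Order.TotalTheory.arg_maxP _ _ _ i0 (fun j => 0 < x j 0)
  (fun j => y j 0 / x j 0) xi0) => i xi imax.
set c := y i 0 / x i 0 in imax.
have yi : 0 < y i 0 by rewrite -sE.
have yic : y i 0 = c * x i 0 by rewrite divfK // gt_eqF.
have yx j : y j 0 <= c * x j 0.
  have [xj|xj] := boolP (0 < x j 0); first by rewrite -ler_pdivrMr //; exact: imax.
  (* Off the common support, 0 separates the two sides. *)
  by apply: (@le_trans _ _ 0); [rewrite leNgt -sE | rewrite mulr_ge0 ?divr_ge0].
have := tensor_apply_le_scale ZA y0 yx yic.
by rewrite Ay // Ax // mulrCA -exprMn -yic ler_pM2r ?exprn_gt0.
Qed.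

Lemma eigen_on_support_uniq (R : realType) (m n : nat) (A : tensor R m.+1 n)
    (x y : 'cV[R]_n) (l k : R) :
  Z_tensor (- A) \/ Z_tensor A -> nonneg_vec x -> nonneg_vec y ->
  vec_support x = vec_support y -> vec_support x != finset.set0 ->
  eigen_on_support A l x -> eigen_on_support A k y -> l = k.
Proof.
move=> ZA x0 y0 sxy sx; have sy : vec_support y != finset.set0 by rewrite -sxy.
(* [A], [l] and [k] vary because the other case negates all three; [x], [y] and their supports stay
   fixed. *)
wlog ZNA : A l k ZA / Z_tensor (- A) => [hw|] Ax Ay.
  case: (ZA) => [|ZA']; first by move=> ZNA; exact: (hw A).
  have ZNN : Z_tensor (- - A) by rewrite opprK.
  apply: oppr_inj; apply: (hw (- A)) => //; first by left.
  - exact: eigen_on_supportN.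
  - exact: eigen_on_supportN.
apply/eqP; rewrite eq_le.
rewrite (eigen_on_support_le ZNA y0 x0 _ sy Ay Ax) //.
exact: (eigen_on_support_le ZNA x0 y0 _ sx Ax Ay).
Qed.

(** Following [f] by the position in an enumeration of the nonempty subsets gives an injection into
    an initial segment of the naturals. *)
Lemma card_le_nonempty_subsets (T : Type) (n : nat) (B : set T)
    (f : T -> {set 'I_n}) :
  (forall a, B a -> f a != finset.set0) -> {in B &, injective f} ->
  B #<= `I_(2 ^ n - 1)%N.
Proof.
move=> f0 finj; pose S : {set {set 'I_n}} := [set~ finset.set0]%SET.
have cS : #|S| = (2 ^ n - 1)%N.
  by rewrite cardsC1 -cardsT -powersetT card_powerset cardsT card_ord subn1.
have fS a : B a -> f a \in enum S by move=> Ba; rewrite mem_enum !inE f0.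
apply/pcard_leP/injfunPex; exists (fun a => index (f a) (enum S)).
  by move=> a Ba /=; rewrite -cS cardE index_mem fS.
move=> a b aB bB e; apply: finj => //.
exact: (index_inj finset.set0 (fS a (set_mem aB)) (fS b (set_mem bB)) e).
Qed.

Theorem proposition4p3 (R : realType) (m n : nat) (hn : (0 < n)%N)
    (A : tensor R m.+1 n) (hA : Z_tensor (- A) \/ Z_tensor A) :
  [set lambda : R | pareto_eigenvalue A lambda] #<= `I_(2 ^ n - 1)%N.
Proof.
(* [choice] asks for a vector at every real, so the property is an implication and other reals get
   the dummy value 0. *)
have /choice[v vP] (l : R) : exists x : 'cV[R]_n, pareto_eigenvalue A l ->
    [/\ vec_support x != finset.set0, nonneg_vec x & eigen_on_support A l x].
  have [/pareto_eigenvalue_support[x xP]|nl] := pselect (pareto_eigenvalue A l).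
    by exists x.
  by exists 0 => /nl.
apply: (@card_le_nonempty_subsets _ _ _ (fun l => vec_support (v l))).
  by move=> l /vP[].
move=> l k /set_mem/vP[sl vl Al] /set_mem/vP[_ vk Ak] slk.
exact: (eigen_on_support_uniq hA vl vk slk sl Al Ak).
Qed.
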